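(* Let $\kappa$ be a cardinal such that $\mathfrak{c}=\kappa^+>\aleph_\omega$, and assume moreover that $2^\lambda<\lambda^{+\omega}$ for every cardinal $\lambda\ge\kappa$ and that $2^\lambda=\lambda^+$ for every cardinal $\lambda$ with $\kappa\le\lambda<\kappa^{+\omega}$. Then $\mathbf{S}\neq\emptyset$, in fact $\aleph_\omega\in\mathbf{S}$, but there is no connected $T_{3.5}$ pd-example.
   Context: For a family of sets $\mathcal{A}$, $\mathrm{pd}(\mathcal{A})$ is the smallest cardinality of a set that intersects every non-empty member of $\mathcal{A}$. A neighborhood assignment on a topological space $X$ is a family $\{U_x : x\in X\}$ where each $U_x$ is an open subset of $X$ containing $x$. The pinning down number of $X$ is $\mathrm{pd}(X)=\sup\{\mathrm{pd}(\mathcal{U}) : \mathcal{U}\text{ is a neighborhood assignment on }X\}$. $\mathrm{d}(X)$ is the density of $X$. $X$ is called a pd-example if $\mathrm{pd}(X)<\mathrm{d}(X)$. $\mathbf{S}$ is the class of all singular cardinals that are not strong limit, and $\mathfrak{c}=2^{\aleph_0}$. $\lambda^{+\omega}$ is the supremum of the finite successors $\lambda^{+n}$, $n<\omega$. $T_{3.5}$ means completely regular and Hausdorff. *)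

(* Defs.v *)
From mathcomp Require Import all_boot.
From mathcomp Require Import mathcomp_extra boolp classical_sets functions cardinality.
From mathcomp Require wochoice.
From mathcomp Require Import reals topology normedtype.

Set Implicit Arguments.
Unset Strict Implicit.
Unset Printing Implicit Defensive.

Local Open Scope classical_set_scope.
Local Open Scope card_scope.

(* A cardinal is represented by any type of that cardinality, so equality of
   cardinals is [=c]. All cardinals live in one fixed universe, which contains
   the carriers of the topological spaces below. *)
Definition cardinal := Type.

Definition cardinal_le (K L : cardinal) : Prop := [set: K] #<= [set: L].
Definition cardinal_eq (K L : cardinal) : Prop := [set: K] #= [set: L].
Definition cardinal_lt (K L : cardinal) : Prop :=
  cardinal_le K L /\ ~ cardinal_le L K.

Notation "K <=c L" := (cardinal_le K L) (at level 70, no associativity).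
Notation "K <c L" := (cardinal_lt K L) (at level 70, no associativity).
Notation "K =c L" := (cardinal_eq K L) (at level 70, no associativity).

Lemma cardinal_leP (K L : cardinal) :
  K <=c L <-> exists f : K -> L, injective f.
Proof.
split=> [/card_leP[f]|[f injf]].
  exists (fun x => val (f (SigSub (mem_set I : x \in [set: K])))).
  by move=> x y /val_inj /(@inj _ _ _ f); rewrite !in_setT => /(_ isT isT) [].
have /injfunPex[g] : exists2 g : K -> L, set_fun [set: K] [set: L] g & set_inj [set: K] g.
  by exists f => // x y _ _; exact: injf.
exact: inj_card_le.
Qed.

Lemma cardinal_le_refl (K : cardinal) : K <=c K.
Proof. by apply/cardinal_leP; exists id. Qed.

Lemma cardinal_le_trans (K L M : cardinal) : K <=c L -> L <=c M -> K <=c M.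
Proof. exact: card_le_trans. Qed.

Definition is_least_cardinal (P : cardinal -> Prop) (K : cardinal) : Prop :=
  P K /\ forall L : cardinal, P L -> K <=c L.

(* The least cardinal satisfying [P]; by [least_cardinalP] the default [void]
   is used only when no cardinal satisfies [P]. *)
Definition least_cardinal (P : cardinal -> Prop) : cardinal :=
  if pselect (exists K, is_least_cardinal P K) is left h then sval (cid h)
  else void.

(* Take a maximal set of points of the product on which every projection is
   injective: some projection maps it onto its factor. *)
Lemma exists_least_in_family (I : Type) (T : I -> Type) (i0 : I) :
  exists i, forall j, T i <=c T j.
Proof.
pose inj_proj (F : set (forall i, T i)) :=
  forall i f g, F f -> F g -> f i = g i -> f = g.
have [F0 F0F totF|F [injF maxF]] := @Zorn_bigcup _ inj_proj.
  move=> i f g [A FA Af] [B FB Bg] fg.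
  by have [AB|BA] := totF _ _ FA FB;
    [apply: (F0F _ FB i)|apply: (F0F _ FA i)] => //; [exact: AB|exact: BA].
have [[i surj]|nsurj] := pselect (exists i, forall t, exists2 f, F f & f i = t).
  exists i => j; pose h t : forall i, T i := s2val (cid2 (surj t)).
  have Fh t : F (h t) by rewrite /h; case: cid2.
  have hi t : h t i = t by rewrite /h; case: cid2.
  apply/cardinal_leP; exists (fun t => h t j) => x y hxy.
  by rewrite -(hi x) -(hi y) (injF j _ _ (Fh x) (Fh y) hxy).
have miss i : exists t, forall f, F f -> f i <> t.
  apply: contrapT => nex; apply: nsurj; exists i => t.
  by apply: contrapT => nf; apply: nex; exists t => f Ff fit; apply: nf; exists f.
pose g i := sval (cid (miss i)).
have gP i f : F f -> f i <> g i by exact: (svalP (cid (miss i))).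
have nFg : ~ F g by move=> Fg; exact: (gP i0 g Fg).
case: (maxF (F `|` [set g])).
  by split; [left|move=> h; apply: nFg; apply: h; right].
move=> i f h [Ff|->] [Fh|->] //.
- exact: (injF i).
- by move/(gP i _ Ff).
- by move/esym/(gP i _ Fh).
Qed.

Lemma cardinal_le_total (K L : cardinal) : K <=c L \/ L <=c K.
Proof.
have [b h] := @exists_least_in_family bool (fun b => if b then K else L) true.
by case: b h => h; [left; exact: (h false)|right; exact: (h true)].
Qed.

Lemma least_cardinalP (P : cardinal -> Prop) :
  (exists K, P K) -> is_least_cardinal P (least_cardinal P).
Proof.
move=> exP; rewrite /least_cardinal.
case: pselect => [h|nh]; first exact: (svalP (cid h)).
exfalso; apply: nh; case: exP => K PK.
pose good (A : set K) := exists L : cardinal, P L /\ [set: L] #= A.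
have goodT : good [set: K] by exists K; split=> //; exact: card_eqxx.
pose T (A : {A : set K | good A}) : Type := sval A.
have [[A [L [PL LA]]] leastA] := @exists_least_in_family _ T (exist _ _ goodT).
exists L; split=> // M PM.
have LT B : L <=c T B.
  apply: cardinal_le_trans (leastA B).
  have := card_eq_trans LA (card_setT_sym A).
  by rewrite card_eq_le => /andP[].
have [/cardinal_leP[f injf]|KM] := cardinal_le_total M K; last first.
  apply: cardinal_le_trans KM; apply: cardinal_le_trans (LT (exist _ _ goodT)) _.
  by apply/cardinal_leP; exists val; exact: val_inj.
have fM : range f #= [set: M] by apply: inj_card_eq => x y _ _; exact: injf.
have goodM : good (range f) by exists M; split=> //; rewrite card_eq_sym.
apply: cardinal_le_trans (LT (exist _ _ goodM)) _.
have := card_eq_trans (card_setT (range f)) fM.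
by rewrite card_eq_le => /andP[].
Qed.

Definition successor (K : cardinal) : cardinal :=
  least_cardinal (fun L => K <c L).

Definition sup_cardinal (I : Type) (F : I -> cardinal) : cardinal :=
  least_cardinal (fun L => forall i, F i <=c L).

Lemma successorP (K : cardinal) :
  is_least_cardinal (fun L => K <c L) (successor K).
Proof.
apply: least_cardinalP; exists (set K); split.
  by apply/cardinal_leP; exists set1 => x y xy; have : [set y] x by rewrite -xy.
move=> /cardinal_leP[f injf].
pose D := [set x | exists2 A, f A = x & ~ A x].
have nD : ~ D (f D) by move=> /[dup] DfD [A /injf ->].
by apply: (nD); exists D.
Qed.

Lemma sup_cardinalP (I : Type) (F : I -> cardinal) :
  is_least_cardinal (fun L => forall i, F i <=c L) (sup_cardinal F).
Proof.
apply: least_cardinalP; exists {i & F i} => i.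
by apply/cardinal_leP; exists (existT F i) => x y; exact: (@existT_inj2 {classic I}).
Qed.

(* K^{+omega}, with K^{+n} the n-fold successor of K *)
Definition omega_successor (K : cardinal) : cardinal :=
  sup_cardinal (fun n : nat => iter n successor K).

Definition aleph_omega : cardinal := omega_successor nat.

(* 2^K *)
Definition power_cardinal (K : cardinal) : cardinal := set K.

Definition continuum : cardinal := power_cardinal nat.

(* The order type of [R] is the initial ordinal of [K]; [~~ R x y] says that
   [y] lies strictly below [x]. *)
Definition initial_well_order (K : cardinal) (R : rel K) : Prop :=
  wochoice.well_order R /\ forall x, {y | ~~ R x y} <c K.

Lemma exists_initial_well_order (K : cardinal) :
  exists R : rel K, initial_well_order R.
Proof.
have [R0 wo0] := wochoice.well_ordering_principle {classic K}.
have ch0 : wochoice.wo_chain R0 predT by move=> A _; exact: wo0.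
have tot0 : total R0 by move=> x y; exact: (wochoice.wo_chainW ch0).
have anti0 : antisymmetric R0.
  by move=> x y; exact: (wochoice.wo_chain_antisymmetric ch0).
pose small x := {y | ~~ R0 x y} <c K.
have [allsmall|] := pselect (forall x, small x); first by exists R0.
move=> /existsNP nsmall.
have [x [[/asboolP xbig xmin] _]] : exists! z,
    wochoice.minimum_of R0 [pred x | `[< ~ small x >]] z.
  by apply: wo0; case: nsmall => x xP; exists x; apply/asboolP.
have /cardinal_leP[f injf] : K <=c {y | ~~ R0 x y}.
  apply: contrapT => nKx; apply: xbig; split=> //.
  by apply/cardinal_leP; exists val; exact: val_inj.
pose g k := val (f k); have injg : injective g by move=> k l /val_inj /injf.
exists (relpre g R0); split.
  apply: wochoice.antisymmetric_well_order.
    by move=> k l /anti0 /injg.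
  move=> A [k Ak].
  have [z [[/asboolP[l Al <-] lmin] _]] : exists! z,
      wochoice.minimum_of R0 [pred z | `[< exists2 l, l \in A & g l = z >]] z.
    by apply: wo0; exists (g k); apply/asboolP; exists k.
  by exists l; split=> // m Am; apply: lmin; apply/asboolP; exists m.
move=> k; have gk_small : small (g k).
  apply: contrapT => gk_big; have := valP (f k).
  by rewrite xmin//; apply/asboolP.
have seg_le : {l | ~~ relpre g R0 k l} <=c {y | ~~ R0 (g k) y}.
  apply/cardinal_leP.
  exists (fun l => exist (fun y => ~~ R0 (g k) y) (g (val l)) (valP l)).
  by move=> l m /(congr1 val) /injg /val_inj.
split; first exact: cardinal_le_trans seg_le gk_small.1.
by move=> /cardinal_le_trans/(_ seg_le); exact: gk_small.2.
Qed.

Definition cofinal (K : Type) (R : rel K) (A : set K) : Prop :=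
  forall x, exists2 y, A y & R x y.

Definition cofinality (K : cardinal) : cardinal :=
  least_cardinal (fun L => exists R : rel K, initial_well_order R /\
    exists2 A : set K, cofinal R A & A =c L).

Lemma cofinalityP (K : cardinal) :
  is_least_cardinal (fun L => exists R : rel K, initial_well_order R /\
    exists2 A : set K, cofinal R A & A =c L) (cofinality K).
Proof.
apply: least_cardinalP; have [R woR] := exists_initial_well_order K.
exists (set_type [set: K]), R; split=> //; exists setT; last exact: card_eqxx.
move=> x; exists x => //.
have ch : @wochoice.wo_chain {classic K} R predT by move=> B _; exact: woR.1.
exact: (wochoice.wo_chain_reflexive ch).
Qed.

Definition singular (K : cardinal) : Prop :=
  infinite_set [set: K] /\ cofinality K <c K.

Definition strong_limit (K : cardinal) : Prop :=
  forall L : cardinal, L <c K -> power_cardinal L <c K.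

Definition class_S (K : cardinal) : Prop := singular K /\ ~ strong_limit K.

Definition pinning_down (X : Type) (A : set (set X)) : cardinal :=
  least_cardinal (fun L => exists2 P : set X,
    (forall U, A U -> U !=set0 -> (P `&` U) !=set0) & P =c L).

Lemma pinning_downP (X : Type) (A : set (set X)) :
  is_least_cardinal (fun L => exists2 P : set X,
    (forall U, A U -> U !=set0 -> (P `&` U) !=set0) & P =c L) (pinning_down A).
Proof.
apply: least_cardinalP; exists (set_type [set: X]), setT; last exact: card_eqxx.
by move=> U _; rewrite setTI.
Qed.

Definition neighborhood_assignment (X : topologicalType) : Type :=
  {U : X -> set X | forall x, open (U x) /\ U x x}.

Definition pinning_down_number (X : topologicalType) : cardinal :=
  sup_cardinal (fun U : neighborhood_assignment X => pinning_down (range (sval U))).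

Definition density (X : topologicalType) : cardinal :=
  least_cardinal (fun L => exists2 D : set X, dense D & D =c L).

Lemma densityP (X : topologicalType) :
  is_least_cardinal (fun L => exists2 D : set X, dense D & D =c L) (density X).
Proof.
apply: least_cardinalP; exists (set_type [set: X]), setT; last exact: card_eqxx.
by move=> U; rewrite setIT.
Qed.

Definition pd_example (X : topologicalType) : Prop :=
  pinning_down_number X <c density X.

Definition T35_space (X : topologicalType) : Prop :=
  completely_regular_space X /\ hausdorff_space X.

(* Main.v *)
From Stdlib Require Import Relation_Operators Wellfounded.
Require Import Defs.
From mathcomp Require Import all_boot all_order all_algebra.
From mathcomp Require Import boolp classical_sets functions cardinality.
From mathcomp Require wochoice.
From mathcomp Require Import reals topology normedtype.
From mathcomp Require Import Rstruct.
From mathcomp Require Import lra.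

Set Implicit Arguments.
Unset Strict Implicit.
Unset Printing Implicit Defensive.

Local Open Scope classical_set_scope.

(** That aleph_omega lies in S is immediate: it has countable cofinality, and
    it is not a strong limit because 2^aleph_0 = kappa^+ lies above it.

    For the second half let X be connected and completely regular Hausdorff,
    and put M = pd(X). If X has at most one point, then d(X) = pd(X), so let
    it have two. A continuous function
    separating a point from the complement of a neighborhood takes every value
    in [0, 1], by connectedness. Hence M is infinite, and every non-empty open
    set has at least c = kappa^+ points.

    Call an open set G cardinal-minimal if all its non-empty open subsets have
    the cardinality |G|. Each non-empty open set contains one, and a maximal
    disjoint family of them has at most M members and a dense union. So
    d(X) <= M follows ([density_le]) once each cardinal-minimal G has a dense
    subset of size at most M. Suppose that some G has none. The whole argument
    rests on [pin_small_family]: for at most |G| non-empty open subsets V_i of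
    G one can choose distinct points x_i in V_i, so the V_i are part of a
    neighborhood assignment, and a single set of size M meets all of them.
    This has two consequences.

    - |G| <= 2^M ([cardinal_minimal_le_power]). If G has at most |G| regular
      open subsets, a set meeting all of them is dense in G by regularity.
      Otherwise take |G| regular open sets; two distinct ones differ by a set
      with interior, so a set of size M can be found that separates them all
      by their traces on it.
    - No family of |G| sets of size at most M is such that every subset of G of
      size at most M is contained in a member ([not_covered]): the members are
      not dense in G, and a set of size M would meet all the complements of
      their closures.

    But cardinal arithmetic does produce such a family. If |G| = 2^M, all
    subsets of size at most M will do, as (2^M)^M = 2^M ([covered_power]). If
    |G| < 2^M, then kappa <= M, since otherwise 2^M <= 2^kappa = kappa^+ <= |G|;
    moreover M <= |G|, since otherwise G is a dense subset of itself of size at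
    most M. So M <= |G| < 2^M < M^{+omega}, that is |G| = M^{+n} for some n,
    and such families of size M^{+n} exist by induction on n, every subset of
    M^{+(n+1)} of size M being bounded ([covered_successor]). *)

(** * Comparison of cardinals *)

Lemma cardinal_le_inj (K L : cardinal) (f : K -> L) : injective f -> K <=c L.
Proof. by move=> injf; apply/cardinal_leP; exists f. Qed.

Lemma cardinal_le_surj (K L : cardinal) (f : L -> K) :
  (forall y, exists x, f x = y) -> K <=c L.
Proof.
move=> surjf; pose g y := sval (cid (surjf y)).
by apply: (@cardinal_le_inj _ _ g) => x y gxy;
  rewrite -(svalP (cid (surjf x))) -(svalP (cid (surjf y))) -/(g x) gxy.
Qed.

Lemma set_le_subset (T : Type) (A B : set T) : A `<=` B -> A <=c B.
Proof.
move=> AB; apply: (@cardinal_le_inj _ _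
  (fun a : A => SigSub (mem_set (AB _ (set_mem (valP a)))) : B)).
by move=> x y /(congr1 val) /= /val_inj.
Qed.

Lemma set_le_type (T : Type) (A : set T) : A <=c T.
Proof. by apply: (@cardinal_le_inj _ _ val); exact: val_inj. Qed.

Lemma image_le (I T : Type) (f : I -> T) (A : set I) : (f @` A : set T) <=c A.
Proof.
pose g (a : A) : (f @` A : set T) :=
  SigSub (mem_set (imageP f (set_mem (valP a)))).
apply: (@cardinal_le_surj _ _ g) => -[y yP].
have [x Ax xy] := set_mem yP.
by exists (SigSub (mem_set Ax)); apply: val_inj.
Qed.

Lemma range_le (I T : Type) (f : I -> T) : (range f : set T) <=c I.
Proof. exact: cardinal_le_trans (image_le f setT) (set_le_type _). Qed.

Lemma cardinal_eq_le (K L : cardinal) : K =c L -> K <=c L /\ L <=c K.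
Proof. by rewrite /cardinal_eq /cardinal_le card_eq_le => /andP[]. Qed.

Lemma cardinal_nle_lt (K L : cardinal) : ~ K <=c L -> L <c K.
Proof. by move=> nKL; split=> //; case: (cardinal_le_total K L). Qed.

Lemma cardinal_lt_le_trans (K L M : cardinal) : K <c L -> L <=c M -> K <c M.
Proof.
move=> [KL nLK] LM; split; first exact: cardinal_le_trans KL LM.
by move=> MK; apply: nLK; exact: cardinal_le_trans LM MK.
Qed.

Lemma cardinal_le_lt_trans (K L M : cardinal) : K <=c L -> L <c M -> K <c M.
Proof.
move=> KL [LM nML]; split; first exact: cardinal_le_trans KL LM.
by move=> MK; apply: nML; exact: cardinal_le_trans MK KL.
Qed.

Lemma power_le (K L : cardinal) :
  K <=c L -> power_cardinal K <=c power_cardinal L.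
Proof.
move=> /cardinal_leP[f injf].
apply: (@cardinal_le_inj _ _ (fun A : set K => f @` A)).
move=> A B fAB; apply/seteqP; split=> x.
  by rewrite -(image_inj injf) fAB image_inj.
by rewrite -(image_inj injf) -fAB image_inj.
Qed.

Lemma cardinal_lt_power (K : cardinal) : K <c power_cardinal K.
Proof.
split; first apply: (@cardinal_le_inj _ _ set1) => x y xy.
  by have : [set y] x by rewrite -xy.
move=> /cardinal_leP[f injf].
pose D := [set x | exists2 A, f A = x & ~ A x].
have nD : ~ D (f D) by move=> /[dup] DfD [A /injf ->].
by apply: (nD); exists D.
Qed.

Lemma prod_le (K K' L L' : cardinal) :
  K <=c K' -> L <=c L' -> (K * L)%type <=c (K' * L')%type.
Proof.
move=> /cardinal_leP[f injf] /cardinal_leP[g injg].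
apply: (@cardinal_le_inj _ _ (fun p => (f p.1, g p.2))).
by move=> [a b] [c d] /= [/injf -> /injg ->].
Qed.

Lemma successor_gt (K : cardinal) : K <c successor K.
Proof. exact: (successorP K).1. Qed.

Lemma successor_le (K L : cardinal) : K <c L -> successor K <=c L.
Proof. exact: (successorP K).2. Qed.

Lemma lt_successor_le (K L : cardinal) : L <c successor K -> L <=c K.
Proof.
move=> [_ nKL]; apply: contrapT => nLK; apply: nKL.
by apply: successor_le; exact: cardinal_nle_lt.
Qed.

(** * Transfinite choice and squares of infinite cardinals *)

Lemma well_order_strict (K : Type) (R : rel K) : wochoice.well_order R ->
  [/\ well_founded (fun y x => ~~ R x y),
      forall x y, [\/ ~~ R y x, x = y | ~~ R x y] &
      forall x y z, ~~ R y x -> ~~ R z y -> ~~ R z x].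
Proof.
move=> woR.
have ch : @wochoice.wo_chain {classic K} R predT by move=> A _; exact: woR.
have tot x y : R x y || R y x by exact: (wochoice.wo_chainW ch).
have anti x y : R x y -> R y x -> x = y.
  move=> xy yx.
  by apply: (wochoice.wo_chain_antisymmetric ch) => //; apply/andP.
split.
- move=> x; apply: contrapT => nAx.
  have [z [[/asboolP nAz zmin] _]] : exists! z, wochoice.minimum_of R
      [pred z | `[< ~ Acc (fun y x => ~~ R x y) z >]] z.
    by apply: woR; exists x; apply/asboolP.
  apply: nAz; constructor => y zy; apply: contrapT => nAy.
  by move: zy; rewrite zmin//; apply/asboolP.
- move=> x y; have [xy|] := boolP (R x y); last by constructor 3.
  by have [yx|] := boolP (R y x); [constructor 2; exact: anti|constructor 1].
- suff trans : transitive R.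
    move=> x y z nyx; apply: contra => zx; apply: trans zx _.
    by have := tot x y; rewrite (negPf nyx) orbF.
  move=> y x z xy yz.
  have [t [[/asboolP txyz tmin] _]] : exists! t, wochoice.minimum_of R
      [pred t | `[< [\/ t = x, t = y | t = z] >]] t.
    by apply: woR; exists x; apply/asboolP; constructor 1.
  have tx : R t x by apply: tmin; apply/asboolP; constructor 1.
  have ty : R t y by apply: tmin; apply/asboolP; constructor 2.
  have tz : R t z by apply: tmin; apply/asboolP; constructor 3.
  case: txyz => tE; first by rewrite -tE.
    by rewrite (anti x y) // -tE.
  by rewrite -(anti y z) // -tE.
Qed.

Lemma initial_order (K : cardinal) :
  exists lt : K -> K -> Prop, [/\ well_founded lt,
    forall x y, [\/ lt x y, x = y | lt y x],
    forall x y z, lt x y -> lt y z -> lt x z & forall x, {y | lt y x} <c K].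
Proof.
have [R [woR small]] := exists_initial_well_order K.
have [wf tri trans] := well_order_strict woR.
by exists (fun y x => ~~ R x y).
Qed.

(** The points are chosen by recursion along [lt]: those chosen before stage
    [i] are indexed by the segment below [i], which is too small for them to
    exhaust [V i]. *)
Lemma injective_choice (I T : Type) (lt : I -> I -> Prop) (V : I -> set T) :
  well_founded lt -> (forall i j, [\/ lt i j, i = j | lt j i]) ->
  (forall i, ~ V i <=c {j | lt j i}) ->
  exists2 x : I -> T, injective x & forall i, V i (x i).
Proof.
move=> wf tot big.
have step i (g : forall j, lt j i -> T) :
    exists y, V i y /\ forall j (h : lt j i), y <> g j h.
  apply: contrapT => nex; apply: (big i).
  apply: cardinal_le_trans _
    (range_le (fun j : {j | lt j i} => g (sval j) (proj2_sig j))).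
  apply: set_le_subset => y Vy; apply: contrapT => ny; apply: nex; exists y.
  split=> // j h yg; apply: ny.
  by exists (exist (fun j => lt j i) j h).
pose F i g := sval (cid (step i g)).
pose x := Fix wf (fun=> T) F.
have xE i : x i = F i (fun j _ => x j).
  apply: (Fix_eq wf (fun=> T) F) => {}i f g fg.
  by congr (F i _); apply/functional_extensionality_dep => j; apply/funext => h.
have xV i : V i (x i) by rewrite xE /F; case: cid => ? [].
have ne i j : lt j i -> x i <> x j.
  by move=> ji; rewrite xE /F; case: cid => y [_ /=]; apply.
exists x => // i j xij.
by have [/ne|//|/ne] := tot i j; rewrite xij.
Qed.

(** Hilbert's hotel: shift an embedded copy of [nat] by one to make room for
    [None]. *)
Lemma option_le (K : cardinal) : nat <=c K -> option K <=c K.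
Proof.
move=> /cardinal_leP[f injf].
have ex t : exists u, (exists2 n, t = f n & u = f n.+1) \/
    (~ range f t /\ u = t).
  have [[n _ <-]|nt] := pselect (range f t); last by exists t; right.
  by exists (f n.+1); left; exists n.
have [h hP] := choice ex.
apply: (@cardinal_le_inj _ _ (fun o => if o is Some t then h t else f 0)).
move=> [t|] [u|] //.
- case: (hP t) (hP u) => [[n -> ->]|[nt ->]] [[m -> ->]|[nu ->]].
  + by move=> /injf [->].
  + by move=> fu; case: nu; exists n.+1.
  + by move=> tf; case: nt; exists m.+1.
  + by move=> ->.
- by case: (hP t) => [[n _ ->] /injf //|[nt ->] tf]; case: nt; exists 0.
- by case: (hP u) => [[n _ ->] /injf //|[nt ->] tf]; case: nt; exists 0.
Qed.

Lemma closed_segment_le_option (K : Type) (lt : K -> K -> Prop) (x : K) :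
  [set y | lt y x \/ y = x] <=c option {y | lt y x}.
Proof.
pose g (o : option {y | lt y x}) := if o is Some y then sval y else x.
have gP o : g o \in [set y | lt y x \/ y = x].
  by rewrite inE; case: o => [[y yx]|]; [left|right].
apply: (@cardinal_le_surj _ _ (fun o => SigSub (gP o))) => -[y yP].
have [yx|yx] := set_mem yP; last by exists None; exact: val_inj.
by exists (Some (exist _ y yx)); exact: val_inj.
Qed.

Lemma prod_finite (K : cardinal) : ~ nat <=c K -> ~ nat <=c (K * K)%type.
Proof.
move=> finK; apply/finite_setPn; rewrite -setXTT.
by apply: finite_setX; apply/finite_setPn.
Qed.

Lemma option_finite (K : cardinal) : ~ nat <=c K -> ~ nat <=c option K.
Proof.
move=> /finite_setPn finK; apply/finite_setPn.
have -> : [set: option K] = Some @` setT `|` [set None].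
  by apply/seteqP; split=> -[x|] // _; [left; exists x|right].
by rewrite finite_setU; split; [exact: finite_image|exact: finite_set1].
Qed.

(** In a least counterexample [K], order the pairs by their maximum and then
    lexicographically. The pairs below a given one lie in the square of a
    proper initial segment, which has fewer than [K] elements by minimality.
    So [injective_choice] finds distinct elements of [K] for all pairs. *)
Lemma prod_self_le (K : cardinal) : nat <=c K -> (K * K)%type <=c K.
Proof.
move=> infK; apply: contrapT => nKK.
pose P (L : cardinal) := nat <=c L /\ ~ (L * L)%type <=c L.
have [|] := @least_cardinalP P; first by exists K.
move: (least_cardinal P) => {nKK infK}K [infK nKK] minK.
apply: nKK; have [lt [wf tri trans small]] := initial_order K.
pose m (p : K * K) := if pselect (lt p.1 p.2) is left _ then p.2 else p.1.
have m1 p : lt p.1 (m p) \/ p.1 = m p.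
  by rewrite /m; case: pselect => h; [left|right].
have m2 p : lt p.2 (m p) \/ p.2 = m p.
  rewrite /m; case: pselect => h; first by right.
  by have [//|->|] := tri p.1 p.2; [right|left].
(* The strict order of the pairs is that of the triples [e p]. *)
pose lt2 := slexprod K K lt lt; pose lt3 := slexprod K (K * K) lt lt2.
pose e (p : K * K) := (m p, p).
pose ltp p q := lt3 (e p) (e q).
have wfp : well_founded ltp.
  apply: (wf_inverse_image _ _ lt3 e).
  exact: wf_slexprod _ _ _ _ wf (wf_slexprod _ _ _ _ wf wf).
have trip p q : [\/ ltp p q, p = q | ltp q p].
  rewrite /ltp /e; case: (tri (m p) (m q)) => [h|mE|h].
  - by constructor 1; left.
  - case: p q mE => a b [c d] mE; rewrite mE.
    case: (tri a c) => [h|<-|h].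
    + by constructor 1; right; left.
    + case: (tri b d) => [h|<-|h].
      * by constructor 1; right; right.
      * by constructor 2.
      * by constructor 3; right; right.
    + by constructor 3; right; left.
  - by constructor 3; left.
have [|g injg _] :=
    @injective_choice _ _ ltp (fun=> [set: K]) wfp trip; last first.
  exact: (cardinal_le_inj injg).
move=> p Kp; pose S := [set y | lt y (m p) \/ y = m p].
have KSS : K <=c (S * S)%type.
  apply: cardinal_le_trans (cardinal_le_trans Kp _).
    by have [] := cardinal_eq_le (card_setT_sym [set: K]).
  have seg q : ltp q p -> S q.1 /\ S q.2.
    have le_trans x y z : lt x y \/ x = y -> lt y z \/ y = z -> lt x z \/ x = z.
      by move=> [xy|->] // [yz|<-]; left=> //; exact: trans xy yz.
    move=> qp; have mqp : lt (m q) (m p) \/ m q = m p.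
      by inversion qp; [left|right].
    by split; [exact: le_trans (m1 q) mqp|exact: le_trans (m2 q) mqp].
  pose f (q : {q | ltp q p}) : S * S :=
    (SigSub (mem_set (seg _ (svalP q)).1),
     SigSub (mem_set (seg _ (svalP q)).2)).
  apply: (@cardinal_le_inj _ _ f) => -[[a b] q] [[c d] r] [/= ac bd].
  by move: q r; rewrite ac bd => q r; congr exist; exact: Prop_irrelevance.
have SoS := closed_segment_le_option lt (m p).
have [infS|finS] := pselect (nat <=c {y | lt y (m p)}); last first.
  apply: (prod_finite (option_finite finS)).
  by apply: cardinal_le_trans (cardinal_le_trans infK KSS) _; exact: prod_le.
have [_] := small (m p); apply.
apply: cardinal_le_trans KSS _.
have Sseg : S <=c {y | lt y (m p)}.
  exact: cardinal_le_trans SoS (option_le infS).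
apply: cardinal_le_trans (prod_le Sseg Sseg) _.
apply: contrapT => nseg; have [_] := small (m p); apply.
by apply: minK; split.
Qed.

Lemma set_le_sig (T : Type) (P : T -> Prop) : [set x | P x] <=c {x | P x}.
Proof.
apply: (@cardinal_le_surj _ _
  (fun x : {x | P x} => SigSub (mem_set (proj2_sig x : [set x | P x] _)))).
move=> [x xP]; exists (exist _ x (set_mem xP)); exact: val_inj.
Qed.

(** Transfinite choice in the family with constant value [L] takes the place of
    a comparison of ordinals. *)
Lemma le_initial_segments (K L : cardinal) (lt : K -> K -> Prop) :
  well_founded lt -> (forall x y, [\/ lt x y, x = y | lt y x]) ->
  (forall x, {y | lt y x} <c L) -> K <=c L.
Proof.
move=> wf tri small.
have [|g injg _] := @injective_choice _ _ lt (fun=> [set: L]) wf tri.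
  move=> x Lx; have [_] := small x; apply; apply: cardinal_le_trans _ Lx.
  by have [] := cardinal_eq_le (card_setT_sym [set: L]).
exact: cardinal_le_inj injg.
Qed.

Lemma injective_selection (I T : Type) (L : cardinal) (V : I -> set T) :
  I <=c L -> (forall i, L <=c V i) ->
  exists2 x : I -> T, injective x & forall i, V i (x i).
Proof.
move=> IL LV; have [lt [wf tri _ small]] := initial_order I.
apply: (@injective_choice _ _ lt) => // i Vi; have [_] := small i; apply.
exact: cardinal_le_trans (cardinal_le_trans IL (LV i)) Vi.
Qed.

(** A point of the union is coded by an index and its position in that member,
    and [M * M] has the cardinality of [M]. *)
Lemma bigcup_le (I T : Type) (M : cardinal) (F : I -> set T) :
  nat <=c M -> I <=c M -> (forall i, F i <=c M) ->
  (\bigcup_i F i : set T) <=c M.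
Proof.
move=> infM IM FM; apply: cardinal_le_trans _ (prod_self_le infM).
apply: cardinal_le_trans _ (prod_le IM (cardinal_le_refl M)).
have ex (t : (\bigcup_i F i : set T)) : exists i, F i (val t).
  by have [i _ Fit] := set_mem (valP t); exists i.
have [i iP] := choice ex.
pose f j := sval (cid ((cardinal_leP (F j) M).1 (FM j))).
have fP j : injective (f j) by rewrite /f; case: cid.
apply: (@cardinal_le_inj _ _
  (fun t => (i t, f (i t) (SigSub (mem_set (iP t)))))) => s t [ist].
have := iP s; have := iP t.
move: (mem_set (iP s)) (mem_set (iP t)); rewrite ist => Fs Ft _ _.
by move=> /fP /(congr1 val) /= /val_inj.
Qed.

(** * Covering all subsets of size M *)

(** This bounds by [L] the covering number of the subsets of [G] of size at most
    [M]. The index type ranges over all types of size at most [L], so that a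
    cover can be indexed by whatever codes its members. *)
Definition covered (M L : cardinal) (T : Type) (G : set T) : Prop :=
  exists2 I : cardinal, I <=c L & exists2 B : I -> set T,
    (forall i, B i <=c M) &
    forall A : set T, A `<=` G -> A <=c M -> exists i, A `<=` B i.

(** A cover of the subsets of the larger set is pulled back along an
    injection. *)
Lemma covered_subset_le (M L N : cardinal) (T : Type) (G : set T) :
  covered M L [set: N] -> G <=c N -> covered M L G.
Proof.
move=> [I IL [B BM Bcov]] /cardinal_leP[f injf].
exists I => //; exists (fun i => [set val g | g in f @^-1` B i]) => [i|A AG AM].
  apply: cardinal_le_trans (image_le _ _) _; apply: cardinal_le_trans _ (BM i).
  have fB (g : (f @^-1` B i : set G)) : f (val g) \in B i.
    by apply: mem_set; exact: (set_mem (valP g)).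
  apply: (@cardinal_le_inj _ _ (fun g => SigSub (fB g) : B i)).
  by move=> g h /(congr1 val) /injf /val_inj.
pose j (a : A) : G := SigSub (mem_set (AG _ (set_mem (valP a)))).
have [//||i Ai] := Bcov (range (f \o j)).
  exact: cardinal_le_trans (range_le _) AM.
exists i => a Aa; exists (j (SigSub (mem_set Aa))) => //.
by apply: Ai; exists (SigSub (mem_set Aa)).
Qed.

(** The successor [K] of [L] is regular, so a subset of size at most [M] is
    bounded: it lies in a closed initial segment [S x], which has size at most
    [L] and hence a cover with [L] members. The covers of the [K] segments
    have at most [K * L = K] members altogether. *)
Lemma covered_successor (M L : cardinal) :
  nat <=c M -> M <=c L -> covered M L [set: L] ->
  covered M (successor L) [set: successor L].
Proof.
move=> infM ML covL; have infL := cardinal_le_trans infM ML.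
set K := successor L; have [lt [wf tri _ small]] := initial_order K.
pose S (x : K) := [set y | lt y x \/ y = x].
have segL x : {y | lt y x} <=c L by exact: lt_successor_le (small x).
have SL x : S x <=c L.
  apply: cardinal_le_trans (closed_segment_le_option lt x) _.
  apply: cardinal_le_trans _ (option_le infL).
  have /cardinal_leP[f injf] := segL x.
  apply: (@cardinal_le_inj _ _ (omap f)) => -[a|] [b|] //=.
  by move=> [/injf ->].
pose cov x := cid2 (covered_subset_le covL (SL x)).
pose I x := s2val (cov x); have IL x : I x <=c L := s2valP (cov x).
pose B x : I x -> set K := s2val (cid2 (s2valP' (cov x))).
have BM x i : B x i <=c M by exact: (s2valP (cid2 (s2valP' (cov x)))).
have Bcov x A : A `<=` S x -> A <=c M -> exists i, A `<=` B x i.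
  exact: (s2valP' (cid2 (s2valP' (cov x)))).
exists {x & I x}.
  have LK : L <=c K by case: (successor_gt L).
  apply: cardinal_le_trans _ (prod_self_le (cardinal_le_trans infL LK)).
  have IK x : I x <=c K by exact: cardinal_le_trans (IL x) LK.
  pose f x := sval (cid ((cardinal_leP (I x) K).1 (IK x))).
  have fP x : injective (f x) by rewrite /f; case: cid.
  apply: (@cardinal_le_inj _ _ (fun p => (tag p, f (tag p) (tagged p)))).
  by move=> [x i] [y j] /= [xy]; move: j; rewrite -xy => j /fP ->.
exists (fun p => B (tag p) (tagged p)) => [p|A _ AM]; first exact: BM.
suff [x AS] : exists x, A `<=` S x.
  by have [i Ai] := Bcov x A AS AM; exists (existT _ x i).
(* Otherwise [K] is the union of the segments below the points of [A]. *)
apply: contrapT => unb; have [_] := successor_gt L; apply.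
apply: cardinal_le_trans
  (_ : (\bigcup_(a : A) [set y | lt y (val a)] : set K) <=c L).
  rewrite (_ : \bigcup_a _ = setT).
    by have [] := cardinal_eq_le (card_setT_sym [set: K]).
  apply/seteqP; split=> // x _; apply: contrapT => nx; apply: unb; exists x.
  move=> a Aa; have [ax|ax|xa] := tri a x; [by left|by right|].
  by exfalso; apply: nx; exists (SigSub (mem_set Aa)).
apply: bigcup_le infL (cardinal_le_trans AM ML) _ => a.
exact: cardinal_le_trans (set_le_sig _) (segL (val a)).
Qed.

(** * The cardinals below the omega-th successor *)

Lemma le_iter_successor (M : cardinal) (n : nat) : M <=c iter n successor M.
Proof.
elim: n => [|n IH]; first exact: cardinal_le_refl.
by apply: cardinal_le_trans IH _; case: (successor_gt (iter n successor M)).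
Qed.

Lemma lt_omega_successor (M L : cardinal) :
  L <c omega_successor M -> exists n, ~ iter n successor M <=c L.
Proof.
move=> [_ nL]; apply: contrapT => nex; apply: nL.
apply: (sup_cardinalP (fun n => iter n successor M)).2 => n.
by apply: contrapT => nn; apply: nex; exists n.
Qed.

Lemma iter_successor_lt (M : cardinal) (n : nat) :
  iter n successor M <c omega_successor M.
Proof.
apply: cardinal_lt_le_trans (successor_gt _) _.
exact: (sup_cardinalP (fun n => iter n successor M)).1 n.+1.
Qed.

Lemma lt_omega_successor_eq (M L : cardinal) :
  M <=c L -> L <c omega_successor M ->
  exists n, L <=c iter n successor M /\ iter n successor M <=c L.
Proof.
move=> ML /lt_omega_successor [n]; elim: n => [//|n IH] nL.
have [nleL|nle] := pselect (iter n successor M <=c L); last exact: IH.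
exists n; split=> //; apply: lt_successor_le.
exact: cardinal_nle_lt.
Qed.

Lemma covered_iter_successor (M : cardinal) (n : nat) : nat <=c M ->
  covered M (iter n successor M) [set: iter n successor M].
Proof.
move=> infM; elim: n => [|n IH] /=.
  exists unit; first by apply: cardinal_le_trans _ infM;
    apply: (@cardinal_le_inj _ _ (fun=> 0)) => -[] [].
  exists (fun=> [set: M]) => [_|A _ _]; last by exists tt.
  exact: set_le_type.
by apply: covered_successor IH => //; exact: le_iter_successor.
Qed.

Lemma covered_lt_omega (M : cardinal) (T : Type) (G : set T) :
  nat <=c M -> M <=c G -> G <c omega_successor M -> covered M G G.
Proof.
move=> infM MG /(lt_omega_successor_eq MG)[n [Gn nG]].
have [I IL BP] := covered_subset_le (covered_iter_successor n infM) Gn.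
by exists I => //; exact: cardinal_le_trans IL nG.
Qed.

(** When [G] has 2^M elements, regard them as subsets of [M]. A subset of [M *
    M] then codes the set of its sections, and these are all the families of
    at most [M] elements. *)
Lemma covered_power (M : cardinal) (T : Type) (G : set T) :
  nat <=c M -> G <=c power_cardinal M -> power_cardinal M <=c G ->
  covered M G G.
Proof.
move=> infM /cardinal_leP[f injf] MG.
exists (power_cardinal (M * M)%type).
  exact: cardinal_le_trans (power_le (prod_self_le infM)) MG.
exists (fun s : set (M * M)%type =>
  val @` [set g : G | exists m, f g = [set n | s (m, n)]]) => [s|A AG].
  apply: cardinal_le_trans (image_le _ _) _.
  have ex (g : [set g : G | exists m, f g = [set n | s (m, n)]]) :
      exists m, f (val g) = [set n | s (m, n)] by exact: (set_mem (valP g)).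
  have [h hP] := choice ex.
  apply: (@cardinal_le_inj _ _ h) => a b hab.
  by apply/val_inj/injf; rewrite !hP hab.
pose j (a : A) : G := SigSub (mem_set (AG _ (set_mem (valP a)))).
move=> /cardinal_leP[h injh].
exists [set p | exists2 a, p.1 = h a & f (j a) p.2] => a Aa.
exists (j (SigSub (mem_set Aa))) => //=.
exists (h (SigSub (mem_set Aa))); apply/seteqP; split=> n /=.
  by move=> fn; exists (SigSub (mem_set Aa)).
by move=> [b /injh <-].
Qed.

Lemma aleph_omega_gt_nat : nat <c aleph_omega.
Proof. exact: (iter_successor_lt nat 0). Qed.

(** For each [n] pick a point [x n] with more than aleph_n predecessors; it
    exists since otherwise aleph_omega would have at most aleph_(n+1)
    elements. The segment below any point has size at most some aleph_n, so
    the points [x n] are cofinal. *)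
Lemma singular_aleph_omega : singular aleph_omega.
Proof.
split; first by apply/infiniteP; case: aleph_omega_gt_nat.
apply: cardinal_le_lt_trans aleph_omega_gt_nat.
have [R [woR small]] := exists_initial_well_order aleph_omega.
have [wf tri trans] := well_order_strict woR.
have ex n : exists x, ~ {y | ~~ R x y} <=c iter n successor nat.
  apply: contrapT => nex; have [_] := iter_successor_lt nat n.+1; apply.
  apply: (le_initial_segments wf tri) => x.
  apply: cardinal_le_lt_trans _ (successor_gt _).
  by apply: contrapT => nx; apply: nex; exists x.
have [x xP] := choice ex.
apply: cardinal_le_trans _ (range_le x).
apply: (cofinalityP aleph_omega).2; exists R; split=> //.
exists (range x); last exact: card_eqxx.
move=> y; have [n yn] := lt_omega_successor (small y).
exists (x n); first by exists n.
apply: contrapT => /negP xny; apply: (xP n).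
have yn' : {z | ~~ R y z} <=c iter n successor nat.
  by case: (cardinal_nle_lt yn).
apply: cardinal_le_trans _ yn'.
pose g (z : {z | ~~ R (x n) z}) : {z | ~~ R y z} :=
  exist _ (sval z) (trans _ _ _ (proj2_sig z) xny).
by apply: (@cardinal_le_inj _ _ g) => a b /(congr1 sval) /= /val_inj.
Qed.

(** * Pinning down and cardinal-minimal open sets *)

Definition pinned (X : topologicalType) (M : cardinal) : Prop :=
  forall U : X -> set X, (forall x, open (U x) /\ U x x) ->
  exists2 P : set X, P <=c M & forall x, P `&` U x !=set0.

Lemma pinned_pinning_down_number (X : topologicalType) :
  pinned X (pinning_down_number X).
Proof.
move=> U oU; pose N : neighborhood_assignment X := exist _ U oU.
have [[P Ppin PE] _] := pinning_downP (range U).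
exists P; last first.
  by move=> x; apply: Ppin; [exists x|exists x; exact: (oU x).2].
apply: cardinal_le_trans (cardinal_eq_le PE).1 _.
exact: ((sup_cardinalP
  (fun U : neighborhood_assignment X => pinning_down (range (sval U)))).1 N).
Qed.

Definition dense_in (X : topologicalType) (G D : set X) : Prop :=
  forall V, open V -> V !=set0 -> V `<=` G -> (D `&` V) !=set0.

Definition cardinal_minimal (X : topologicalType) (G : set X) : Prop :=
  [/\ open G, G !=set0 &
    forall V, open V -> V !=set0 -> V `<=` G -> G <=c V].

Lemma exists_cardinal_minimal (X : topologicalType) (V : set X) :
  open V -> V !=set0 -> exists2 G, cardinal_minimal G & G `<=` V.
Proof.
move=> oV V0.
pose S := {W : set X | [/\ open W, W !=set0 & W `<=` V]}.
have VS : [/\ open V, V !=set0 & V `<=` V] by split.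
have [[G [oG G0 GV]] minG] := @exists_least_in_family S
  (fun W => set_type (sval W)) (exist _ V VS).
exists G => //; split=> // W oW W0 WG.
have WS : [/\ open W, W !=set0 & W `<=` V].
  by split=> //; exact: subset_trans WG GV.
exact: (minG (exist _ W WS)).
Qed.

Section cardinal_minimal_open_set.
Variables (X : topologicalType) (M : cardinal) (G : set X).
Hypotheses (pinX : pinned X M) (minG : cardinal_minimal G).

(** Since each [V i] is as large as [G], distinct points can be selected from
    them; assigning [V i] to the point selected from it, and the whole space
    to all other points, gives a neighborhood assignment. *)
Lemma pin_small_family (I : Type) (V : I -> set X) :
  I <=c G -> (forall i, [/\ open (V i), V i !=set0 & V i `<=` G]) ->
  exists2 P : set X, P <=c M & forall i, P `&` V i !=set0.
Proof.
move=> IG VP; have [_ _ leG] := minG.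
have [|x injx Vx] := injective_selection IG (V := V).
  by move=> i; have [oV V0 VG] := VP i; exact: leG.
have ex y : exists U, (open U /\ U y) /\ forall i, x i = y -> U = V i.
  have [[i <-]|ny] := pselect (exists i, x i = y).
    by exists (V i); split=> [|j /injx ->//]; split=> //; case: (VP i).
  exists setT; split=> [|i xy]; first by split=> //; exact: openT.
  by case: ny; exists i.
have [U UP] := choice ex.
have [|P PM Ppin] := pinX (U := U); first by move=> y; case: (UP y).
by exists P => // i; rewrite -((UP (x i)).2 i erefl).
Qed.

(** The members of a cover have size at most [M], so they are not dense in [G]
    and [pin_small_family] applies to the complements of their closures. The
    trace on [G] of the resulting set is covered by some [B i], but it meets
    the complement of the closure of [B i]. *)
Lemma not_covered : ~ (exists2 D : set X, D <=c M & dense_in G D) ->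
  ~ covered M G G.
Proof.
move=> nD [I IG [B BM Bcov]]; have [oG _ _] := minG.
have [|P PM Ppin] := pin_small_family IG (V := fun i => G `\` closure (B i)).
  move=> i; split; [|apply: contrapT => G0|exact: subDsetl].
    by rewrite setDE; apply: openI oG (closed_openC (@closed_closure _ _)).
  apply: nD; exists (B i) => // V oV [x Vx] VG.
  have xB : closure (B i) x.
    by apply: contrapT => nx; apply: G0; exists x; split=> //; exact: VG.
  exact: (xB V (open_nbhs_nbhs (conj oV Vx))).
have [|i Pi] := Bcov (P `&` G) (@subIsetr _ _ _).
  exact: cardinal_le_trans (set_le_subset (@subIsetl _ _ _)) PM.
have [p [Pp [Gp]]] := Ppin i; apply.
by apply: subset_closure; exact: Pi.
Qed.

Lemma regopen_open (W : set X) : regopen W -> open W.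
Proof. by rewrite /regopen => <-; exact: open_interior. Qed.

Lemma regopen_setD_closure (V W : set X) : regopen V -> regopen W ->
  ~ V `<=` W -> V `\` closure W !=set0.
Proof.
move=> roV roW nVW; apply: contrapT => V0; apply: nVW.
rewrite -[W]roW -open_subsetE; last exact: regopen_open.
by move=> x Vx; apply: contrapT => nx; apply: V0; exists x.
Qed.

Lemma regular_regopen_base (V : set X) : regular_space X ->
  open V -> V !=set0 -> exists W, [/\ regopen W, W !=set0 & W `<=` V].
Proof.
move=> regX oV [x Vx].
have [C Cx CV] := regX x V (open_nbhs_nbhs (conj oV Vx)).
exists (closure C)°; split.
- exact: interior_closed_regopen (@closed_closure _ _).
- by exists x; apply: interiorS (@subset_closure _ _) _ _.
- by apply: subset_trans CV; exact: interior_subset.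
Qed.

(** If there are at most [G] regular open subsets of [G], a set that meets the
    non-empty ones is dense in [G], as these sets form a base. Otherwise
    choose [G] of them. Any two differ by a set with non-empty interior, and
    as [G * G] has the size of [G], one set [P] of size at most [M] meets all
    these differences. The chosen sets then have distinct traces on [P]. *)
Lemma cardinal_minimal_le_power : regular_space X -> nat <=c G ->
  ~ (exists2 D : set X, D <=c M & dense_in G D) ->
  G <=c power_cardinal M.
Proof.
move=> regX infG nD; have [oG _ _] := minG.
pose RO := [set W : set X | regopen W /\ W `<=` G].
have [ROG|GRO] := cardinal_le_total RO G.
  exfalso; apply: nD.
  pose I := [set W | RO W /\ W !=set0].
  have IRO : I `<=` RO by move=> W [].
  have [||P PM Ppin] := pin_small_family (I := I) (V := fun W => val W).
  - exact: cardinal_le_trans (set_le_subset IRO) ROG.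
  - move=> W; have [[roW WG] W0] := set_mem (valP W).
    by split=> //; exact: regopen_open.
  exists P => // V oV V0 VG.
  have [W [roW W0 WV]] := regular_regopen_base regX oV V0.
  have IW : I W by split=> //; split=> //; exact: subset_trans WV VG.
  have [p [Pp Wp]] := Ppin (SigSub (mem_set IW)).
  by exists p; split=> //; exact: WV.
have /cardinal_leP[h injh] := GRO.
have roh a : regopen (val (h a)) by case: (set_mem (valP (h a))).
have hG a : val (h a) `<=` G by case: (set_mem (valP (h a))).
pose I := [set ab : G * G | val (h ab.1) `\` closure (val (h ab.2)) !=set0].
have [||P PM Ppin] := pin_small_family (I := I)
  (V := fun ab => val (h (val ab).1) `\` closure (val (h (val ab).2))).
- exact: cardinal_le_trans (set_le_type _) (prod_self_le infG).
- move=> ab; split.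
  + rewrite setDE; apply: openI (closed_openC (@closed_closure _ _)).
    exact: regopen_open (roh _).
  + exact: (set_mem (valP ab)).
  + by move=> x [/hG].
apply: cardinal_le_trans _ (power_le PM).
have sub a b : val @^-1` val (h a) = val @^-1` val (h b) :> set P ->
    val (h a) `<=` val (h b).
  move=> ab; apply: contrapT => /(regopen_setD_closure (roh a) (roh b)) ne.
  have [p [Pp [hap nhbp]]] := Ppin (SigSub (mem_set (ne : I (a, b)))).
  apply: nhbp; apply: subset_closure.
  by have <- : (val @^-1` val (h a)) (SigSub (mem_set Pp)) =
    val (h b) p by rewrite ab.
apply: (@cardinal_le_inj _ _ (fun a : G => val @^-1` val (h a) : set P)).
move=> a b ab; apply/injh/val_inj/seteqP; split; exact: sub.
Qed.

End cardinal_minimal_open_set.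

(** A maximal disjoint family of cardinal-minimal open sets has at most [M]
    members, because one neighborhood assignment gives each point of a member
    that member. By maximality every non-empty open set meets some member, so
    the union of dense subsets of the members is dense. *)
Lemma density_le (X : topologicalType) (M : cardinal) :
  nat <=c M -> pinned X M ->
  (forall G : set X, cardinal_minimal G ->
     exists2 D : set X, D <=c M & dense_in G D) ->
  density X <=c M.
Proof.
move=> infM pinX dG.
have [E [Emin disjE maxE]] := @ex_maximal_disjoint_subcollection (set X) X id
  [set G | cardinal_minimal G].
have eqE G H x : E G -> E H -> G x -> H x -> G = H.
  by move=> EG EH Gx Hx; apply: disjE => //; exists x.
have EM : E <=c M.
  have ex y : exists U, (open U /\ U y) /\ forall G, E G -> G y -> U = G.
    have [[G EG Gy]|ny] := pselect (exists2 G, E G & G y).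
      exists G; split=> [|H EH Hy]; last exact: eqE EG EH Gy Hy.
      by split=> //; case: (Emin _ EG).
    exists setT; split=> [|G EG Gy]; first by split=> //; exact: openT.
    by case: ny; exists G.
  have [U UP] := choice ex.
  have [|P PM Ppin] := pinX U; first by move=> y; case: (UP y).
  apply: cardinal_le_trans PM.
  have exp (G : E) : exists p : P, val G (val p).
    have EG := set_mem (valP G); have [_ [x Gx] _] := Emin _ EG.
    have [p [Pp]] := Ppin x; rewrite ((UP x).2 _ EG Gx) => Gp.
    by exists (SigSub (mem_set Pp)).
  have [p pP] := choice exp.
  apply: (@cardinal_le_inj _ _ p) => G H pGH; apply: val_inj.
  apply: (eqE _ _ (val (p G))); try exact: set_mem (valP _).
    exact: pP.
  by rewrite pGH; exact: pP.
have exD (G : E) : exists D : set X, D <=c M /\ dense_in (val G) D.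
  by have [D DM DG] := dG _ (Emin _ (set_mem (valP G))); exists D.
have [D DP] := choice exD.
apply: cardinal_le_trans (_ : (\bigcup_G D G : set X) <=c M); last first.
  by apply: bigcup_le => // G; case: (DP G).
apply: (densityP X).2; exists (\bigcup_G D G); last exact: card_eqxx.
move=> V V0 oV.
have [G minG GV] := exists_cardinal_minimal oV V0.
have [oG [g Gg] _] := minG.
have [H [EH HG]] : exists H, E H /\ G `&` H !=set0.
  apply: contrapT => nH.
  have nEG : ~ E G by move=> EG; apply: nH; exists G; split=> //; exists g.
  apply: (maxE (E `|` [set G])).
  - split; first exact: subsetUl.
    by move=> /(_ G (or_intror erefl)).
  - by move=> K [/Emin//|->].
  - move=> A B [EA|->] [EB|->] // AB; first exact: disjE AB.
      by case: nH; exists A; rewrite setIC.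
    by case: nH; exists B.
have [oH _ _] := Emin _ EH.
have [_ /(_ (G `&` H))] := DP (SigSub (mem_set EH)).
case=> [|//|//|x [Dx [Gx Hx]]]; first exact: openI.
by exists x; split; [exact: GV|exists (SigSub (mem_set EH))].
Qed.

(** * Open subsets of connected completely regular spaces *)

Section real_functions.
Import Order.TTheory GRing.Theory Num.Theory numFieldNormedType.Exports.
Local Open Scope ring_scope.
Variable R : realType.

(** Reading the characteristic function of [A] as digits in base 3 embeds the
    continuum into [0, 1). As the digit 2 never occurs, all digits beyond the
    first [n] contribute at most half of 3^-n, and so a difference in one
    digit cannot be made up by the later ones. *)
Definition ternary_digit (A : set nat) (k : nat) : R :=
  if `[< A k >] then 3^-1 ^+ k.+1 else 0.

Definition ternary_sum (A : set nat) (n : nat) : R :=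
  \sum_(k < n) ternary_digit A k.

Definition ternary (A : set nat) : R := sup (range (ternary_sum A)).

Lemma ternary_sumS A n :
  ternary_sum A n.+1 = ternary_sum A n + ternary_digit A n.
Proof. by rewrite /ternary_sum big_ord_recr. Qed.

Lemma ternary_digit_bounds A n : 0 <= ternary_digit A n <= 3^-1 ^+ n.+1.
Proof.
have p : 0 <= 3^-1 ^+ n.+1 :> R by apply: exprn_ge0; lra.
by rewrite /ternary_digit; case: asboolP => _; rewrite ?lexx ?p.
Qed.

Lemma ternary_sum_le A n m : ternary_sum A m <= ternary_sum A n + 3^-1 ^+ n / 2.
Proof.
have [mn|nm] := leqP m n.
  suff : ternary_sum A m <= ternary_sum A n.
    by have := exprn_ge0 n (_ : 0 <= 3^-1 :> R); lra.
  rewrite -(subnK mn) addnC; elim: (n - m)%N => [|j IH]; first by rewrite addn0.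
  by rewrite addnS ternary_sumS; have := ternary_digit_bounds A (m + j); lra.
suff : ternary_sum A m + 3^-1 ^+ m / 2 <= ternary_sum A n + 3^-1 ^+ n / 2.
  by have := exprn_ge0 m (_ : 0 <= 3^-1 :> R); lra.
rewrite -(subnK (ltnW nm)) addnC; elim: (m - n)%N => [|j IH].
  by rewrite addn0.
apply: le_trans IH; rewrite addnS ternary_sumS.
by have := ternary_digit_bounds A (n + j); rewrite exprS; lra.
Qed.

Lemma ternary_le A n : ternary A <= ternary_sum A n + 3^-1 ^+ n / 2.
Proof.
apply: ge_sup; first by exists (ternary_sum A 0), 0%N.
by move=> _ [m _ <-]; exact: ternary_sum_le.
Qed.

Lemma ternary_ge A n : ternary_sum A n <= ternary A.
Proof.
apply: ub_le_sup; last by exists n.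
exists (ternary_sum A 0 + 3^-1 ^+ 0 / 2) => _ [m _ <-].
exact: ternary_sum_le.
Qed.

Lemma ternary_lt A B n : (forall k, (k < n)%N -> A k <-> B k) ->
  A n -> ~ B n -> ternary B < ternary A.
Proof.
move=> AB An nBn.
have ABn : ternary_sum A n = ternary_sum B n.
  apply: eq_bigr => k _; rewrite /ternary_digit.
  by rewrite (asbool_equiv_eq (AB k (ltn_ord k))).
apply: le_lt_trans (ternary_le B n.+1) _.
apply: lt_le_trans _ (ternary_ge A n.+1).
rewrite !ternary_sumS ABn /ternary_digit asboolF// asboolT//.
by have := exprn_gt0 n.+1 (_ : 0 < 3^-1 :> R); lra.
Qed.

Lemma ternary_inj : injective ternary.
Proof.
move=> A B cAB; suff AB n : A n <-> B n by apply/seteqP; split=> n /AB.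
elim/ltn_ind: n => n IH; split=> [An|Bn]; apply: contrapT => nn.
  by have := ternary_lt IH An nn; rewrite cAB ltxx.
have := ternary_lt (fun k kn => iff_sym (IH k kn)) Bn nn.
by rewrite cAB ltxx.
Qed.

Lemma ternary_itv A : 0 <= ternary A < 1.
Proof.
have := ternary_ge A 0; have := ternary_le A 0.
by rewrite /ternary_sum big_ord0 expr0; lra.
Qed.

(** Complete regularity separates [x] from the complement of [G] together with
    [y]. The second point makes the value 1 occur even if [G] is the whole
    space, and the range is an interval since the space is connected. *)
Lemma connected_separation (X : topologicalType) (G : set X) (x y : X) :
  connected [set: X] -> T35_space X -> open G -> G x -> y <> x ->
  exists f : X -> R, [/\ continuous f, f x = 0,
    forall z, ~ G z -> f z = 1 & forall t, 0 <= t <= 1 -> exists z, f z = t].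
Proof.
move=> conX [crX hX] oG Gx yx.
pose B := ~` G `|` [set y].
have cB : closed B.
  apply: closedU; first exact: open_closedC.
  exact: (accessible_closed_set1 (hausdorff_accessible hX)).
have nBx : ~ B x by move=> [|/esym].
have [f [cf _ f0 f1]] :=
  (uniform_separatorP (R := R) [set x] B).1 (crX _ _ cB nBx).
have fB z : B z -> f z = 1 by move=> Bz; apply: f1; exists z.
have fx : f x = 0 by apply: f0; exists x.
exists f; split=> // [z nGz|t t01]; first by apply: fB; left.
have itvf : is_interval (range f).
  apply/connected_intervalP/connected_continuous_connected => //.
  exact: continuous_subspaceT.
have : range f t.
  apply: (itvf 0 1) => //; first by exists x.
  by exists y => //; apply: fB; right.
by case=> z _ <-; exists z.
Qed.

Lemma continuum_le_open (X : topologicalType) (G : set X) (x y : X) :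
  connected [set: X] -> T35_space X -> open G -> G x -> y <> x ->
  continuum <=c G.
Proof.
move=> conX tX oG Gx yx.
have [f [_ _ f1 ft]] := connected_separation conX tX oG Gx yx.
have ex A : exists g : G, f (val g) = ternary A.
  have /andP[t0 t1] := ternary_itv A.
  have [|z fz] := ft (ternary A); first by rewrite t0 ltW.
  have Gz : G z.
    by apply: contrapT => /f1 fz1; move: t1; rewrite -fz fz1 ltxx.
  by exists (SigSub (mem_set Gz)).
have [g gP] := choice ex.
apply: (@cardinal_le_inj _ _ g) => A B gAB; apply: ternary_inj.
by rewrite -!gP gAB.
Qed.

(** For [f] onto [0, 1], assign to [z] the points where [f] is within a factor
    2 of [f z]. A set pinning this assignment contains for each [n] a point
    where [f] is within a factor 2 of 4^-n, and these points are distinct. *)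
Lemma nat_le_pinned (X : topologicalType) (M : cardinal) (x y : X) :
  connected [set: X] -> T35_space X -> y <> x -> pinned X M -> nat <=c M.
Proof.
move=> conX tX yx pinX.
have [f [cf _ _ ft]] := connected_separation conX tX openT (I : setT x) yx.
pose U z := if 0 < f z then f @^-1` `]f z / 2, f z * 2[ else setT.
have [z|P PM Ppin] := pinX U.
  rewrite /U; case: ifP => fz; last by split=> //; exact: openT.
  split; last by rewrite /= in_itv /=; lra.
  by apply: open_comp => // t _; exact: cf.
apply: cardinal_le_trans PM.
pose e (n : nat) : R := 4^-1 ^+ n.
have e0 n : 0 < e n by apply: exprn_gt0; lra.
have e1 n : e n <= 1 by apply: exprn_ile1; lra.
have eS n : e n.+1 = e n / 4 by rewrite /e exprSr.
have emono n m : (n < m)%N -> e m <= e n / 4.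
  move=> nm; rewrite -(subnK nm) addnC; elim: (m - n.+1)%N => [|j IH].
    by rewrite addn0 eS.
  by rewrite addnS eS; have := e0 (n.+1 + j)%N; lra.
have ex n : exists p : P, e n / 2 < f (val p) < e n * 2.
  have [|z fz] := ft (e n); first by rewrite ltW ?e0 ?e1.
  have [p [Pp]] := Ppin z; rewrite /U fz e0 /= in_itv /= => pe.
  by exists (SigSub (mem_set Pp)).
have [p pP] := choice ex.
apply: (@cardinal_le_inj _ _ p) => n m pnm.
have := pP n; have := pP m; rewrite pnm.
case: (ltngtP n m) => [/emono|/emono|//] nm pm pn;
  by exfalso; clear -nm pm pn; lra.
Qed.

End real_functions.

(** * The absence of connected pd-examples *)

Theorem corollary3p6 (kappa : cardinal)
  (continuum_eq : continuum =c successor kappa)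
  (continuum_gt : aleph_omega <c successor kappa)
  (power_lt : forall lambda : cardinal, kappa <=c lambda ->
     power_cardinal lambda <c omega_successor lambda)
  (power_eq : forall lambda : cardinal, kappa <=c lambda ->
     lambda <c omega_successor kappa ->
     power_cardinal lambda =c successor lambda) :
  [/\ exists lambda : cardinal, class_S lambda,
      class_S aleph_omega &
      ~ exists X : topologicalType,
          [/\ connected [set: X], T35_space X & pd_example X]].
Proof.
have S : class_S aleph_omega.
  split; first exact: singular_aleph_omega.
  move=> /(_ nat aleph_omega_gt_nat) [_]; apply.
  have [_ sc] := cardinal_eq_le continuum_eq.
  by case: continuum_gt => ac _; exact: cardinal_le_trans ac sc.
split=> //; first by exists aleph_omega.
move=> [X [conX tX [_ nd]]].
set M := pinning_down_number X in nd.
have pinX : pinned X M := @pinned_pinning_down_number X.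
(* In a space with at most one point, a set meeting the whole space is dense. *)
have [[x [y yx]]|sub] := pselect (exists x y : X, y <> x); last first.
  apply: nd; have [|P PM Ppin] := pinX (fun=> setT).
    by move=> x; split=> //; exact: openT.
  apply: cardinal_le_trans PM.
  apply: (densityP X).2; exists P; last exact: card_eqxx.
  move=> V [v Vv] _; have [p [Pp _]] := Ppin v; exists p; split=> //.
  have -> // : p = v.
  by apply: contrapT => pv; apply: sub; exists v, p.
have infM := @nat_le_pinned Rdefinitions.R _ _ _ _ conX tX yx pinX.
apply: nd; apply: density_le => // G minG.
have [oG [g Gg] _] := minG.
have cG : continuum <=c G.
  have [h hg] : exists h, h <> g.
    by have [<-|] := pselect (x = g); [exists y|exists x].
  exact: (@continuum_le_open Rdefinitions.R _ _ _ _ conX tX oG Gg hg).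
have infG : nat <=c G.
  by apply: cardinal_le_trans cG; case: (cardinal_lt_power nat).
apply: contrapT => nD; apply: (not_covered pinX minG nD).
have regX := completely_regular_regular (R := Rdefinitions.R) tX.1.
have GM := cardinal_minimal_le_power pinX minG regX infG nD.
have [MG|nMG] := pselect (power_cardinal M <=c G); first exact: covered_power.
have kM : kappa <=c M.
  have [//|Mk] := cardinal_le_total kappa M; case: nMG.
  apply: cardinal_le_trans (power_le Mk) _; apply: cardinal_le_trans _ cG.
  have [_ sc] := cardinal_eq_le continuum_eq; apply: cardinal_le_trans _ sc.
  have [|] := cardinal_eq_le (power_eq kappa (cardinal_le_refl _) _) => //.
  exact: (iter_successor_lt kappa 0).
apply: covered_lt_omega => //.
  have [GM'|//] := cardinal_le_total G M.
  case: nD; exists G => // V _ [v Vv] VG.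
  by exists v; split=> //; exact: VG.
exact: cardinal_le_lt_trans GM (power_lt M kM).
Qed.
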